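(* Let $m<n$ and $s\in\{1,\dots,n\}$, let $A\in\mathbb{R}^{m\times n}$ be a matrix with $\ell_2$-normalized columns and coherence $\mu=\mu(A)$, and let $b=Ax+z$ with $x\in\mathbb{R}^n$ and $z\in\mathbb{R}^m$. Let $\lambda>0$. Assume that $$\mu<\frac{1}{4s}\qquad\text{and}\qquad \|A^*z\|_\infty\le \frac{\lambda}{2}.$$ Let $\hat{x}^{L}$ be a solution of the Lasso problem $$\min_{y\in\mathbb{R}^n}\ \lambda\|y\|_1+\frac12\|Ay-b\|_2^2 .$$ Then $$\|\hat{x}^{L}-x\|_2\le\frac{15\sqrt{s}}{8\mu(1-4s\mu)}\lambda+\Big(\frac{2(1+2s)\mu}{1-4s\mu}+\frac{1}{2}\Big)\frac{2\|x_{-\max(s)}\|_1}{\sqrt{s}}.$$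
   Context: For a matrix $A\in\mathbb{R}^{m\times n}$ with columns $A_1,\dots,A_n$ satisfying $\|A_i\|_2=1$ for all $i$, the coherence is $\mu(A)=\max_{1\le i\ne j\le n}|\langle A_i,A_j\rangle|$. $A^*$ denotes the transpose of $A$. For $x\in\mathbb{R}^n$, $x_{\max(s)}$ is the vector $x$ with all but the largest $s$ entries in absolute value set to zero, and $x_{-\max(s)}=x-x_{\max(s)}$. *)

(* Defs.v *)
From mathcomp Require Import all_boot all_order all_algebra.
From mathcomp Require Import reals matrix_normedtype.

Set Implicit Arguments.
Unset Strict Implicit.
Unset Printing Implicit Defensive.

Import Order.TTheory GRing.Theory Num.Theory.
Local Open Scope ring_scope.

(* The l_oo norm is the library's mx_norm, the largest modulus of an entry. *)

Definition inner (R : realType) (n : nat) (u v : 'cV[R]_n) : R :=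
  \sum_(i < n) u i 0 * v i 0.

Definition norm1 (R : realType) (n : nat) (u : 'cV[R]_n) : R :=
  \sum_(i < n) `|u i 0|.

Definition norm2 (R : realType) (n : nat) (u : 'cV[R]_n) : R :=
  Num.sqrt (\sum_(i < n) u i 0 ^+ 2).

Definition normalized_columns (R : realType) (m n : nat) (A : 'M[R]_(m, n)) :
    Prop :=
  forall i : 'I_n, norm2 (col i A) = 1.

(* The default 0 only matters when there is no pair i != j, i.e. n <= 1. *)
Definition coherence (R : realType) (m n : nat) (A : 'M[R]_(m, n)) : R :=
  \big[Num.max/0]_(ij : 'I_n * 'I_n | ij.1 != ij.2)
    `|inner (col ij.1 A) (col ij.2 A)|.

(* A relation rather than a function, because x_max(s) is not unique when
   entries of x tie in absolute value; no tie-breaking rule is imposed. *)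
Definition is_max_part (R : realType) (n s : nat) (x xs : 'cV[R]_n) : Prop :=
  exists S : {set 'I_n},
    [/\ #|S| = s,
        forall i j : 'I_n, i \in S -> j \notin S -> `|x j 0| <= `|x i 0|
      & xs = \col_(i < n) (if i \in S then x i 0 else 0)].

Lemma is_max_part_exists (R : realType) (n s : nat) (x : 'cV[R]_n) :
  (s <= n)%N -> exists xs, is_max_part s x xs.
Proof.
move=> les; pose r := [rel i j : 'I_n | `|x j 0| <= `|x i 0|].
have r_total : total r by move=> i j; exact: le_total.
have r_trans : transitive r by move=> j i k /= ji kj; exact: le_trans kj ji.
pose t := sort r (enum 'I_n).
have t_uniq : uniq t by rewrite sort_uniq enum_uniq.
have t_size : size t = n by rewrite size_sort size_enum_ord.
have t_mem k : k \in t by rewrite mem_sort mem_enum.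
exists (\col_i (if i \in [set k in take s t] then x i 0 else 0)).
exists [set k in take s t]; split=> //.
  have /card_uniqP := take_uniq s t_uniq; rewrite size_takel ?t_size // => cardS.
  by rewrite -[RHS]cardS; apply: eq_card => k; rewrite inE.
move=> i j; rewrite !inE => ti tj.
have dj : j \in drop s t.
  by have := t_mem j; rewrite -{1}(cat_take_drop s t) mem_cat (negPf tj).
have := sort_sorted r_total (enum 'I_n).
rewrite sorted_pairwise // -/t -(cat_take_drop s t) pairwise_cat.
by case/and3P=> /allrelP/(_ i j ti dj).
Qed.

Definition lasso_objective (R : realType) (m n : nat) (A : 'M[R]_(m, n))
    (b : 'cV[R]_m) (lambda : R) (y : 'cV[R]_n) : R :=
  lambda * norm1 y + 1 / 2 * norm2 (A *m y - b) ^+ 2.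

Definition is_lasso_solution (R : realType) (m n : nat) (A : 'M[R]_(m, n))
    (b : 'cV[R]_m) (lambda : R) (xL : 'cV[R]_n) : Prop :=
  forall y : 'cV[R]_n,
    lasso_objective A b lambda xL <= lasso_objective A b lambda y.

(* Main.v *)
(** Put [h := xL - x], [sigma := norm1 (x - xs)], and let [S] support [xs].
Comparing the objective at [xL] and at [x] gives
[norm1 h <= 4 (\sum_(i in S) `|h i|) + 4 sigma]; perturbing [xL] along one
coordinate shows that the entries of [A^T A h] are at most [3 lambda / 2].
As [A^T A] has unit diagonal and off-diagonal entries at most [mu], every entry
of [h] is at most [3 lambda / 2 + mu norm1 h]. Hence, with [D := 1 - 4 s mu],
[D norm1 h <= 6 s lambda + 4 sigma] and [D |h|_oo <= 3 lambda / 2 + 4 mu sigma],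
and the bound follows from [norm2 h ^ 2 <= |h|_oo norm1 h] and AM-GM. The factor
[1 / mu] is only a loss, but it requires [mu > 0], which holds because [m < n]
vectors of dimension [m] cannot be orthonormal. *)
Require Import Defs.
From mathcomp Require Import all_boot all_order all_algebra.
From mathcomp Require Import reals matrix_normedtype.
From mathcomp Require Import ring lra.

Set Implicit Arguments.
Unset Strict Implicit.
Unset Printing Implicit Defensive.

Import Order.TTheory GRing.Theory Num.Theory.
Local Open Scope ring_scope.

Section EuclideanSpace.
Variable R : realType.

Lemma norm2_sqr n (u : 'cV[R]_n) : norm2 u ^+ 2 = inner u u.
Proof.
rewrite /norm2 sqr_sqrtr; last by apply: sumr_ge0 => i _; exact: sqr_ge0.
by apply: eq_bigr => i _; rewrite expr2.
Qed.

Lemma innerC n (u v : 'cV[R]_n) : inner u v = inner v u.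
Proof. by apply: eq_bigr => i _; rewrite mulrC. Qed.

Lemma innerE n (u v : 'cV[R]_n) : inner u v = (u^T *m v) 0 0.
Proof. by rewrite mxE; apply: eq_bigr => i _; rewrite mxE. Qed.

Lemma inner_mulmx m n (A : 'M[R]_(m, n)) (u : 'cV[R]_n) (v : 'cV[R]_m) :
  inner (A *m u) v = inner u (A^T *m v).
Proof. by rewrite !innerE trmx_mul mulmxA. Qed.

Lemma innerNr n (u v : 'cV[R]_n) : inner u (- v) = - inner u v.
Proof. by rewrite !innerE mulmxN mxE. Qed.

Lemma norm2D_sqr n (u v : 'cV[R]_n) :
  norm2 (u + v) ^+ 2 = norm2 u ^+ 2 + 2 * inner u v + norm2 v ^+ 2.
Proof.
rewrite !norm2_sqr /inner mulr_sumr -!big_split; apply: eq_bigr => i _ /=.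
by rewrite !mxE; ring.
Qed.

(** Hölder's inequality for the pair l1, l_oo, with [c] in place of the l_oo norm. *)
Lemma inner_le_norm1 n (u v : 'cV[R]_n) (c : R) :
  (forall i, `|v i 0| <= c) -> inner u v <= c * norm1 u.
Proof.
move=> vc; rewrite /norm1 mulr_sumr; apply: ler_sum => i _.
rewrite (le_trans (ler_norm _)) // normrM mulrC.
exact: ler_wpM2r.
Qed.

Lemma norm2_sqr_le n (u : 'cV[R]_n) (c : R) :
  (forall i, `|u i 0| <= c) -> norm2 u ^+ 2 <= c * norm1 u.
Proof. by move=> uc; rewrite norm2_sqr inner_le_norm1. Qed.

Lemma norm1_ge0 n (u : 'cV[R]_n) : 0 <= norm1 u.
Proof. exact: sumr_ge0. Qed.

Lemma entry_le_mx_norm n (u : 'cV[R]_n) i : `|u i 0| <= mx_norm u.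
Proof.
rewrite mx_normrE.
exact: (Order.TotalTheory.le_bigmax _ (fun ij => `|u ij.1 ij.2|) (i, 0)).
Qed.

End EuclideanSpace.

Section Coherence.
Variables (R : realType) (m n : nat) (A : 'M[R]_(m, n)).

Lemma gramE i j : (A^T *m A) i j = inner (col i A) (col j A).
Proof. by rewrite mxE; apply: eq_bigr => k _; rewrite !mxE. Qed.

Lemma coherence_ge0 : 0 <= coherence A.
Proof. exact: Order.TotalTheory.bigmax_ge_id. Qed.

Lemma gram_le_coherence i j : i != j -> `|(A^T *m A) i j| <= coherence A.
Proof.
move=> ij; rewrite gramE /coherence.
pose F (p : 'I_n * 'I_n) := `|inner (col p.1 A) (col p.2 A)|.
exact: (@Order.TotalTheory.le_bigmax_cond _ _ _ _ (i, j) _ F).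
Qed.

Hypothesis hA : normalized_columns A.

Lemma gram_diag i : (A^T *m A) i i = 1.
Proof. by rewrite gramE -norm2_sqr hA expr1n. Qed.

Lemma coherence_gt0 : (m < n)%N -> 0 < coherence A.
Proof.
move=> mn; rewrite lt_neqAle coherence_ge0 andbT eq_sym; apply/eqP => mu0.
suff /mulmx1_min : A^T *m A = 1%:M by rewrite leqNgt mn.
apply/matrixP => i j; rewrite [RHS]mxE; case: eqVneq => [->|ij].
  exact: gram_diag.
by apply/eqP; rewrite -normr_le0 -mu0 gram_le_coherence.
Qed.

(** The unit diagonal isolates [h i 0] in row [i] of the Gram matrix; the triangle inequality moves
    the off-diagonal remainder [r] to the right. *)
Lemma entry_le_gram (h : 'cV[R]_n) i :
  `|h i 0| <= `|(A^T *m (A *m h)) i 0| + coherence A * norm1 h.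
Proof.
rewrite mulmxA mxE (bigD1 i) //= gram_diag mul1r.
set r := \sum_(j | _) _.
have rle : `|r| <= coherence A * norm1 h.
  rewrite /norm1 (bigD1 i) //= mulrDr mulr_sumr.
  apply: (@le_trans _ _ (\sum_(j | j != i) coherence A * `|h j 0|)); last first.
    by rewrite lerDr mulr_ge0 ?coherence_ge0.
  apply: (le_trans (ler_norm_sum _ _ _)); apply: ler_sum => j ji.
  by rewrite normrM ler_wpM2r // gram_le_coherence // eq_sym.
have := ler_normB (h i 0 + r) r; rewrite addrK; lra.
Qed.

End Coherence.

Section Lasso.
Variables (R : realType) (m n : nat) (A : 'M[R]_(m, n)).
Variables (b : 'cV[R]_m) (lambda : R) (xL : 'cV[R]_n).
Hypothesis lambda_gt0 : 0 < lambda.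
Hypothesis hxL : is_lasso_solution A b lambda xL.

(** First-order optimality: the gradient of the quadratic part lies in [- lambda] times the
    subdifferential of the l1 norm, whose elements have entries of modulus at most 1. *)
Lemma lasso_gradient_le :
  normalized_columns A -> forall i, `|(A^T *m (A *m xL - b)) i 0| <= lambda.
Proof.
move=> hA i; set g := (A^T *m _) i 0.
(* Moving coordinate [i] by [t] raises the l1 norm by at most [|t|] and, the column being of unit
   length, changes the quadratic part by exactly [t * g + t ^+ 2 / 2]. *)
have variation t : 0 <= lambda * `|t| + t * g + t ^+ 2 / 2.
  have := hxL (xL + t *: delta_mx i 0); rewrite /lasso_objective.
  have -> : A *m (xL + t *: delta_mx i 0) - b = (A *m xL - b) + t *: col i A.
    by rewrite mulmxDr -scalemxAr -colE addrAC.
  rewrite (norm2D_sqr (A *m xL - b)).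
  have -> : inner (A *m xL - b) (t *: col i A) = t * g.
    rewrite innerC colE scalemxAr inner_mulmx /inner (bigD1 i) //=.
    rewrite big1 => [|j ji]; first by rewrite -/g addr0 !mxE !eqxx mulr1.
    by rewrite !mxE (negPf ji) mulr0 mul0r.
  have -> : norm2 (t *: col i A) ^+ 2 = t ^+ 2.
    rewrite norm2_sqr -[RHS]mulr1 -(expr1n _ 2) -(hA i) norm2_sqr /inner mulr_sumr.
    by apply: eq_bigr => k _; rewrite !mxE; ring.
  have : norm1 (xL + t *: delta_mx i 0) <= norm1 xL + `|t|.
    rewrite /norm1 (bigD1 i) // [X in _ <= X + _](bigD1 i) //=.
    have -> : \sum_(j | j != i) `|(xL + t *: delta_mx i 0) j 0| =
              \sum_(j | j != i) `|xL j 0|.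
      by apply: eq_bigr => j ji; rewrite !mxE (negPf ji) mulr0 addr0.
    rewrite !mxE !eqxx mulr1.
    by have := ler_normD (xL i 0) t; lra.
  move=> /(ler_wpM2l (ltW lambda_gt0)); lra.
rewrite leNgt; apply/negP; rewrite real_lter_normr ?num_real //.
(* In each case the chosen [t] minimizes the quadratic bound on its half-line, where the value is
   [- t ^+ 2 / 2 < 0]. *)
case/orP => gl.
  by have := variation (lambda - g); rewrite ltr0_norm; [nra|lra].
by have := variation (- g - lambda); rewrite gtr0_norm; [nra|lra].
Qed.

Lemma lasso_cone (x : 'cV[R]_n) (z : 'cV[R]_m) (S : {set 'I_n}) :
    b = A *m x + z -> (forall i, `|(A^T *m z) i 0| <= lambda / 2) ->
  norm1 (xL - x) <= 4 * (\sum_(i in S) `|(xL - x) i 0|)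
                    + 4 * (\sum_(i | i \notin S) `|x i 0|).
Proof.
move=> hb hz; set h := xL - x.
have xLE : xL = x + h by rewrite /h addrC subrK.
clearbody h.
(* The residuals at [xL] and [x] are [A *m h - z] and [- z]: the squared norm of [z] cancels, that
   of [A *m h] is dropped, and the cross term costs half of [lambda * norm1 h]. *)
have normL : norm1 xL <= norm1 x + norm1 h / 2.
  have := hxL x; rewrite /lasso_objective.
  have -> : A *m xL - b = A *m h - z.
    by rewrite hb xLE mulmxDr opprD addrACA subrr add0r.
  have -> : A *m x - b = - z by rewrite hb opprD addrA subrr add0r.
  rewrite norm2D_sqr innerNr inner_mulmx => opt.
  have := inner_le_norm1 h hz => inn.
  have := sqr_ge0 (norm2 (A *m h)) => sq.
  rewrite -(ler_pM2l lambda_gt0); lra.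
(* The triangle inequality is used in opposite ways: [x] is the main term on [S], [h] off [S]. *)
have lowS : \sum_(i in S) `|x i 0| - \sum_(i in S) `|h i 0| <=
            \sum_(i in S) `|xL i 0|.
  rewrite -sumrB; apply: ler_sum => i _; rewrite xLE mxE.
  by have := ler_normB (x i 0 + h i 0) (h i 0); rewrite addrK; lra.
have lowC : \sum_(i | i \notin S) `|h i 0| - \sum_(i | i \notin S) `|x i 0| <=
            \sum_(i | i \notin S) `|xL i 0|.
  rewrite -sumrB; apply: ler_sum => i _; rewrite xLE mxE.
  by have := ler_normB (x i 0 + h i 0) (x i 0); rewrite addrAC subrr add0r; lra.
have split1 (u : 'cV[R]_n) :
    norm1 u = \sum_(i in S) `|u i 0| + \sum_(i | i \notin S) `|u i 0|.
  by rewrite /norm1 (bigID (mem S)).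
move: normL; rewrite !split1; lra.
Qed.

End Lasso.

Lemma norm1_sub_restrict (R : realType) n (x : 'cV[R]_n) (S : {set 'I_n}) :
  norm1 (x - \col_(i < n) (if i \in S then x i 0 else 0)) =
  \sum_(i | i \notin S) `|x i 0|.
Proof.
rewrite /norm1 [RHS]big_mkcond; apply: eq_bigr => i _; rewrite !mxE.
by case: (i \in S); rewrite ?subrr ?normr0 ?subr0.
Qed.

(** AM-GM: the two summands have product [p * q / 4]. *)
Lemma mul_le_sqr_weighted_mean (R : realFieldType) (r p q : R) :
  r != 0 -> p * q <= (r * p + q / (4 * r)) ^+ 2.
Proof.
move=> r0; rewrite -subr_ge0.
have -> : (r * p + q / (4 * r)) ^+ 2 - p * q = (r * p - q / (4 * r)) ^+ 2.
  by field.
exact: sqr_ge0.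
Qed.

Theorem theorem2p1 (R : realType) (m n s : nat) (A : 'M[R]_(m, n))
    (x xs xL : 'cV[R]_n) (z b : 'cV[R]_m) (lambda mu : R)
    (hmn : (m < n)%N) (hs : (1 <= s <= n)%N)
    (hA : normalized_columns A) (hmu : mu = coherence A)
    (hb : b = A *m x + z) (hlambda : 0 < lambda)
    (hcoh : mu < 1 / (4 * s%:R))
    (hz : mx_norm (A^T *m z) <= lambda / 2)
    (hxL : is_lasso_solution A b lambda xL)
    (hxs : is_max_part s x xs) :
  norm2 (xL - x)
    <= 15 * Num.sqrt (s%:R) / (8 * mu * (1 - 4 * s%:R * mu)) * lambda
       + (2 * (1 + 2 * s%:R) * mu / (1 - 4 * s%:R * mu) + 1 / 2)
         * (2 * norm1 (x - xs) / Num.sqrt (s%:R)).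
Proof.
case/andP: hs => s_gt0 _; case: hxs => S [cardS _ ->].
rewrite norm1_sub_restrict; set sigma := \sum_(i | _) _.
have sR : 1 <= s%:R :> R by rewrite ler1n.
have mu_gt0 : 0 < mu by rewrite hmu; exact: coherence_gt0.
have D_gt0 : 0 < 1 - 4 * s%:R * mu.
  by move: hcoh; rewrite ltr_pdivlMr; lra.
have sigma_ge0 : 0 <= sigma by exact: sumr_ge0.
have hz' i : `|(A^T *m z) i 0| <= lambda / 2.
  exact: le_trans (entry_le_mx_norm _ _) hz.
have cone := lasso_cone hlambda hxL S hb hz'; rewrite -/sigma in cone.
set h := xL - x in cone *; set D := 1 - 4 * s%:R * mu in D_gt0 *.
(* The constant is [lambda] from the gradient of the objective plus [lambda / 2] from the noise. *)
have entry i : `|h i 0| <= 3 / 2 * lambda + mu * norm1 h.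
  apply: (le_trans (entry_le_gram hA _ _)); rewrite -hmu lerD2r.
  have := lasso_gradient_le hlambda hxL hA i.
  have -> : A^T *m (A *m xL - b) = A^T *m (A *m h) - A^T *m z.
    by rewrite hb /h !mulmxBr mulmxDr opprD addrA.
  set u := A^T *m (A *m h); set v := A^T *m z; rewrite mxE [(- v) i 0]mxE.
  by have := ler_normD (u i 0 - v i 0) (v i 0); rewrite subrK; have := hz' i; lra.
have sumS : \sum_(i in S) `|h i 0| <= s%:R * (3 / 2 * lambda + mu * norm1 h).
  rewrite -cardS mulr_natl -sumr_const; apply: ler_sum => i _; exact: entry.
pose p := (3 / 2 * lambda + 4 * mu * sigma) / D.
pose q := (6 * s%:R * lambda + 4 * sigma) / D.
(* Inserting [sumS] into [cone] leaves [4 * s%:R * mu * norm1 h] on the right, which is absorbed on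
   the left as [D > 0]. *)
have norm1_le : norm1 h <= q.
  by rewrite /q ler_pdivlMr // /D; lra.
have entry_le i : `|h i 0| <= p.
  apply: (le_trans (entry i)).
  have -> : p = 3 / 2 * lambda + mu * q.
    by rewrite /p /q /D; field; rewrite -/D gt_eqF.
  by rewrite lerD2l ler_pM2l.
pose r := Num.sqrt s%:R : R.
have r_gt0 : 0 < r by rewrite sqrtr_gt0; lra.
have rr : s%:R = r ^+ 2 :> R by rewrite sqr_sqrtr //; lra.
have p_ge0 : 0 <= p.
  by rewrite divr_ge0 ?(ltW D_gt0) // addr_ge0 ?mulr_ge0 //; lra.
have q_ge0 : 0 <= q := le_trans (norm1_ge0 h) norm1_le.
(* With weight [r], the square root of [s], both summands carry the same noise term
   [3 / 2 * r * lambda / D]. *)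
have norm2_le : norm2 h <= r * p + q / (4 * r).
  rewrite -ler_sqr ?nnegrE ?sqrtr_ge0 //; last first.
    have r_ge0 := ltW r_gt0.
    apply: addr_ge0; first exact: mulr_ge0.
    by apply: divr_ge0 => //; exact: mulr_ge0.
  apply: (le_trans (norm2_sqr_le entry_le)).
  apply: (le_trans (ler_wpM2l p_ge0 norm1_le)).
  by rewrite mul_le_sqr_weighted_mean ?gt_eqF.
apply: (le_trans norm2_le); rewrite -/r -subr_ge0.
have D_neq0 : D != 0 by rewrite gt_eqF.
set w := (X in 0 <= X).
(* The slack in the claimed bound. Its [lambda] term is nonnegative because [1 <= s] and [D > 0]
   force [4 * mu <= 1]. *)
have -> : w = (15 - 24 * mu) * r * lambda / (8 * mu * D) + 4 * mu * sigma / (r * D).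
  move: D_neq0; rewrite /w /p /q /D rr => D_neq0.
  by field; rewrite D_neq0 !gt_eqF.
have mu4 : 4 * mu <= 1.
  by apply: le_trans (_ : 4 * s%:R * mu <= 1); [nra|move: D_gt0; rewrite /D; lra].
by rewrite addr_ge0 ?divr_ge0 ?mulr_ge0 //; try apply: ltW => //; lra.
Qed.
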